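(* Let $N\ge 1$ be an integer, $n=\lfloor N/2\rfloor$, let $f$ be a nonzero continuous $2\pi$-periodic function on $[-\pi,\pi]$ with real sampling values at the $N$ equidistant points $x_j=-\pi+2\pi j/N$, $j=0,\dots,N-1$, and let $\tilde c_\ell=\frac{\sqrt{2\pi}}{N}\sum_{j=0}^{N-1}f(x_j)e^{-i\ell x_j}$, $\ell=-n,\dots,n$. (i) If $N$ is odd, the trigonometric interpolation polynomial $\mathcal T_nf(x)=\frac1{\sqrt{2\pi}}\sum_{\ell=-n}^n\tilde c_\ell e^{i\ell x}$ is the unique solution to $$\min_{\boldsymbol\alpha\in\mathbb C^N}\tfrac12\|\mathbf W^{1/2}(\mathbf A\boldsymbol\alpha-\mathbf f)\|_2^2,$$ i.e. the unique minimizer is the coefficient vector $\boldsymbol\alpha=[\tilde c_{-n},\dots,\tilde c_n]^T$. (ii) If $N$ is even, the trigonometric interpolation polynomial $\mathcal T_nf(x)=\frac1{\sqrt{2\pi}}\sum_{\ell=-n}^{n}{}^{'}\,\tilde c_\ell e^{i\ell x}$ is the unique solution to $$\min_{\boldsymbol\beta\in\mathbb C^N}\tfrac12\|\mathbf W^{1/2}(\mathbf B\boldsymbol\beta-\mathbf f)\|_2^2,$$ i.e. the unique minimizer is the coefficient vector $\boldsymbol\beta=[\tilde c_{-n+1},\dots,\tilde c_{n-1},\tilde c_n]^T$.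
   Context: The prime on $\sum'$ means that the terms with $\ell=\pm n$ are multiplied by $1/2$; for $N$ even one has (and the paper assumes) $\tilde c_{-n}=\tilde c_n$. $\mathbf f=[f(x_0),\dots,f(x_{N-1})]^T\in\mathbb R^N$, $\mathbf W=\mathrm{diag}(2\pi/N,\dots,2\pi/N)\in\mathbb R^{N\times N}$. For $N$ odd, $\mathbf A\in\mathbb C^{N\times N}$ has entries $[\mathbf A]_{j+1,\ell+n+1}=e^{i\ell x_j}/\sqrt{2\pi}$ for $j=0,\dots,N-1$, $\ell=-n,\dots,n$. For $N$ even, $\mathbf B\in\mathbb C^{N\times N}$ has entries $[\mathbf B]_{j+1,\ell+n}=e^{i\ell x_j}/\sqrt{2\pi}$ for $\ell=-n+1,\dots,n-1$, and last column $[\mathbf B]_{j+1,N}=\cos(\tfrac N2x_j)/\sqrt{2\pi}$, $j=0,\dots,N-1$. *)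

(* Defs.v *)
From HB Require Import structures.
From mathcomp Require Import all_boot all_order all_algebra.
From mathcomp Require Import all_classical all_reals all_analysis.
From mathcomp Require Import complex.
Set Implicit Arguments.
Unset Strict Implicit.
Unset Printing Implicit Defensive.
Import Order.TTheory GRing.Theory Num.Theory.
Import numFieldNormedType.Exports.
Local Open Scope ring_scope.
Local Open Scope complex_scope.

Section TrigInterpolation.
Context {R : realType}.
Local Notation C := R[i].

(* e^{i t} *)
Definition expi (t : R) : C := cos t +i* sin t.

Definition node (N j : nat) : R := - pi + (2 * pi * j%:R) / N%:R.

Definition ctilde (N : nat) (f : R -> C) (l : int) : C :=
  (Num.sqrt (2 * pi) / N%:R)%:C *
  \sum_(j < N) f (node N j) * expi (- (l%:~R * node N j)).

(* The index k of a sum over 0 <= k < 2n+1 stands for the frequency l = k - n,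
   which runs over -n, ..., n. *)
Definition trig_interp_odd (N : nat) (f : R -> C) (x : R) : C :=
  ((Num.sqrt (2 * pi))^-1)%:C *
  \sum_(k < (N./2).*2.+1)
    let l := k%:Z - (N./2)%:Z in ctilde N f l * expi (l%:~R * x).

(* The primed sum: the terms l = n and l = -n are halved. *)
Definition trig_interp_even (N : nat) (f : R -> C) (x : R) : C :=
  ((Num.sqrt (2 * pi))^-1)%:C *
  \sum_(k < (N./2).*2.+1)
    let l := k%:Z - (N./2)%:Z in
    (if `|l|%N == N./2 then 2^-1 else 1) * (ctilde N f l * expi (l%:~R * x)).

(* Rows and columns are numbered from 0: column k carries the frequency k - n
   for N odd, and k - n + 1 for N even (the last one being k - n + 1 = n). *)
Definition freq_odd (N k : nat) : int := k%:Z - (N./2)%:Z.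
Definition freq_even (N k : nat) : int := k%:Z - (N./2)%:Z + 1.

Definition basis_odd (N k : nat) (x : R) : C :=
  expi ((freq_odd N k)%:~R * x) / (Num.sqrt (2 * pi))%:C.

Definition basis_even (N k : nat) (x : R) : C :=
  (if k == N.-1 then (cos (N%:R / 2 * x))%:C
   else expi ((freq_even N k)%:~R * x)) / (Num.sqrt (2 * pi))%:C.

Definition Amx (N : nat) : 'M[C]_N :=
  \matrix_(j, k) basis_odd N k (node N j).
Definition Bmx (N : nat) : 'M[C]_N :=
  \matrix_(j, k) basis_even N k (node N j).

Definition Wmx (N : nat) : 'M[R]_N := diag_mx (const_mx (2 * pi / N%:R)).

(* D^{1/2} for a diagonal matrix D with nonnegative entries. *)
Definition diag_sqrt (N : nat) (D : 'M[R]_N) : 'M[R]_N :=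
  diag_mx (\row_i Num.sqrt (D i i)).

Definition samples (N : nat) (f : R -> C) : 'cV[C]_N := \col_j f (node N j).

(* Euclidean norm on C^N; the norm of a complex number is valued in C,
   with zero imaginary part. *)
Definition l2norm (N : nat) (v : 'cV[C]_N) : R :=
  Num.sqrt (\sum_i (complex.Re `|v i 0|) ^+ 2).

Definition objective (N : nat) (M : 'M[C]_N) (f : R -> C) (a : 'cV[C]_N) : R :=
  2^-1 * l2norm (map_mx (real_complex R) (diag_sqrt (Wmx N)) *m
                 (M *m a - samples N f)) ^+ 2.

Definition minimizer (T : Type) (F : T -> R) (a : T) : Prop :=
  forall b, F a <= F b.

Definition coef_odd (N : nat) (f : R -> C) : 'cV[C]_N :=
  \col_k ctilde N f (freq_odd N k).
Definition coef_even (N : nat) (f : R -> C) : 'cV[C]_N :=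
  \col_k ctilde N f (freq_even N k).

(* The trigonometric polynomial with coefficient vector a in the basis b. *)
Definition trig_poly (N : nat) (b : nat -> R -> C) (a : 'cV[C]_N) (x : R) : C :=
  \sum_(k < N) a k 0 * b k x.

End TrigInterpolation.

(* Main.v *)
Require Import Defs.
From mathcomp Require Import all_boot all_order all_algebra.
From mathcomp Require Import all_classical all_reals all_analysis.
From mathcomp Require Import complex.
From mathcomp Require Import ring lra zify.
Set Implicit Arguments.
Unset Strict Implicit.
Unset Printing Implicit Defensive.
Import Order.TTheory GRing.Theory Num.Theory.
Import numFieldNormedType.Exports.
Local Open Scope classical_set_scope.
Local Open Scope ring_scope.

(* At the nodes x_j both systems reduce to the matrix with entries
   e^{i (k + s) x_j} / sqrt(2 pi), k = 0, ..., N-1, for some shift s: when N is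
   even, cos (N x_j / 2) = e^{i N x_j / 2} because N x_j / 2 is a multiple of pi.
   By discrete orthogonality (a geometric sum of an N-th root of unity) this
   matrix is invertible and its inverse sends the samples to the vector of the
   c_l. So the least squares problem has residual 0, attained only there. *)

(** * The exponential on the unit circle *)

Section Expi.
Context {R : realType}.
Implicit Types (t u : R) (n : nat).

Lemma expiD t u : expi (t + u) = expi t * expi u.
Proof. by rewrite /expi cosD sinD; simpc; rewrite [sin t * _ + _]addrC. Qed.

Lemma expi0 : expi 0 = 1 :> R[i].
Proof. by rewrite /expi cos0 sin0. Qed.

Lemma expi_natmul n t : expi (n%:R * t) = expi t ^+ n.
Proof.
elim: n => [|n IH]; first by rewrite mul0r expi0.
by rewrite -natr1 mulrDl mul1r expiD IH exprSr.
Qed.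

Lemma expi_pi : expi pi = -1 :> R[i].
Proof. by rewrite /expi cospi sinpi; simpc. Qed.

Lemma expi_2pi : expi (2 * pi) = 1 :> R[i].
Proof. by rewrite expi_natmul expi_pi sqrrN expr1n. Qed.

(** By the half-angle formula cos |t| = 1 - 2 sin^2 (|t| / 2), and |t| / 2 lies in (0, pi), where
    the sine is positive. *)
Lemma expi_neq1 t : 0 < `|t| < 2 * pi -> expi t != 1.
Proof.
move=> /andP[t_gt0 t_lt]; apply/eqP => -[cost1 _].
have : 0 < sin (`|t| / 2) by apply: sin_gt0_pi; apply/andP; split; lra.
move=> sin_gt0; have := cosD (`|t| / 2) (`|t| / 2).
have -> : `|t| / 2 + `|t| / 2 = `|t| by lra.
have -> : cos `|t| = cos t by case: (ger0P t) => // _; rewrite cosN.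
have := cos2Dsin2 (`|t| / 2); have := mulr_gt0 sin_gt0 sin_gt0.
by rewrite cost1 !expr2; lra.
Qed.

Lemma expi_add_expiN t : expi t + expi (- t) = (2 * cos t)%:C%C.
Proof.
apply/eqP; rewrite /expi cosN sinN eq_complex /= subrr eqxx andbT.
by rewrite mulr_natl mulr2n.
Qed.

End Expi.

(** * Weighted least squares with an invertible matrix *)

Section LeastSquares.
Context {R : realType} {N : nat}.
Hypothesis N_gt0 : (0 < N)%N.

Lemma l2norm_eq0 (v : 'cV[R[i]]_N) : l2norm v = 0 -> v = 0.
Proof.
move=> /eqP; rewrite sqrtr_eq0 => le0.
apply/colP => i; rewrite mxE.
have sum0 : \sum_i (complex.Re `|v i 0|) ^+ 2 = 0.
  by apply: le_anti; rewrite le0 sumr_ge0// => j _; exact: sqr_ge0.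
move/psumr_eq0P : sum0 => /(_ (fun j _ => sqr_ge0 _)) /(_ i isT) /eqP.
rewrite sqrf_eq0 => /eqP re0; apply/eqP.
(* The norm is valued in [R[i]]; being real, it equals its real part, which vanishes. *)
by rewrite -normr_eq0 -(RRe_real (normr_real (v i 0))) re0.
Qed.

Lemma l2norm0 : l2norm (0 : 'cV[R[i]]_N) = 0.
Proof.
rewrite /l2norm big1 ?sqrtr0// => i _.
by rewrite mxE normr0 expr0n.
Qed.

Lemma sqrt_weight_mulmx_eq0 (v : 'cV[R[i]]_N) :
  map_mx (real_complex R) (diag_sqrt (Wmx N)) *m v = 0 -> v = 0.
Proof.
rewrite /diag_sqrt map_diag_mx => /colP v0; apply/colP => i.
move: (v0 i); rewrite mul_diag_mx !mxE eqxx mulr1n => /eqP.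
rewrite mulf_eq0 fmorph_eq0 sqrtr_eq0 leNgt.
by rewrite divr_gt0 ?mulr_gt0 ?pi_gt0 ?ltr0n//= => /eqP.
Qed.

(** The nonnegative objective is 0 at [c], hence at every minimizer; as the weights are positive,
    this forces [M *m a = M *m c], and [M] cancels. *)
Lemma minimizer_objectiveP (M : 'M[R[i]]_N) (f : R -> R[i]) (c a : 'cV[R[i]]_N) :
  M \in unitmx -> M *m c = samples N f ->
  minimizer (objective M f) a <-> a = c.
Proof.
move=> M_unit Mc.
have obj_ge0 b : 0 <= objective M f b.
  by rewrite mulr_ge0 ?invr_ge0 ?ler0n// sqr_ge0.
have obj_c : objective M f c = 0.
  by rewrite /objective Mc subrr mulmx0 l2norm0 expr0n mulr0.
split=> [min_a|-> b]; last by rewrite obj_c.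
have /eqP : objective M f a = 0.
  by apply: le_anti; rewrite obj_ge0 -obj_c min_a.
rewrite mulf_eq0 invr_eq0 pnatr_eq0 /= sqrf_eq0 => /eqP /l2norm_eq0.
move=> /sqrt_weight_mulmx_eq0 /subr0_eq; rewrite -Mc.
by move/(congr1 (mulmx (invmx M))); rewrite !mulKmx.
Qed.

Lemma trig_poly_nodes (b : nat -> R -> R[i]) (a : 'cV[R[i]]_N) (j : 'I_N) :
  trig_poly b a (node N j) = ((\matrix_(i, k) b k (node N i)) *m a) j 0.
Proof. by rewrite !mxE; apply: eq_bigr => k _; rewrite mxE mulrC. Qed.

(** Values at the nodes already determine the coefficients. This turns uniqueness of the coefficient
    vector into uniqueness of the polynomial as a function. *)
Lemma trig_poly_inj (b : nat -> R -> R[i]) :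
  (\matrix_(j < N, k < N) b k (node N j)) \in unitmx ->
  injective (@trig_poly R N b).
Proof.
move=> M_unit a a' eq_aa'; apply: (can_inj (mulKmx M_unit)).
by apply/colP => j; rewrite -!trig_poly_nodes eq_aa'.
Qed.

End LeastSquares.

(** * Discrete orthogonality at the equidistant nodes *)

Section DiscreteFourier.
Context {R : realType} {N : nat}.
Hypothesis N_gt0 : (0 < N)%N.
Implicit Types (s : int) (i j : 'I_N).

(** The shift serves both parities: s = -n gives [Amx], s = 1 - n gives [Bmx]. *)
Definition fourier_mx s : 'M[R[i]]_N :=
  \matrix_(j, k) (expi ((k%:Z + s)%:~R * node N j) / (Num.sqrt (2 * pi))%:C%C).

(** The conjugate transpose of [fourier_mx s] times the weight 2 pi / N. *)
Definition fourier_inv s : 'M[R[i]]_N :=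
  \matrix_(k, j) ((Num.sqrt (2 * pi) / N%:R)%:C%C *
                  expi (- ((k%:Z + s)%:~R * node N j))).

Let sqrt2pi_neq0 : (Num.sqrt (2 * pi))%:C%C != 0 :> R[i].
Proof. by rewrite fmorph_eq0 gt_eqF// sqrtr_gt0 mulr_gt0 ?pi_gt0. Qed.

(** Distinct nodes differ by 2 pi (j - i) / N with 0 < |j - i| < N, less than a full turn. *)
Lemma nodeB_neq1 i j : i != j -> expi (node N j - node N i) != 1 :> R[i].
Proof.
move=> neq_ij; have N0 : 0 < N%:R :> R by rewrite ltr0n.
have -> : node N j - node N i = 2 * pi * ((j%:R - i%:R) / N%:R) :> R.
  by rewrite /node; field; rewrite gt_eqF.
have p0 : 0 < 2 * pi :> R by rewrite mulr_gt0 ?pi_gt0.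
apply: expi_neq1; rewrite normrM normf_div (gtr0_norm p0) (gtr0_norm N0).
rewrite pmulr_rgt0// gtr_pMr// divr_gt0//=; last first.
  by rewrite normr_gt0 subr_eq0 eqr_nat eq_sym.
rewrite ltr_pdivrMr// mul1r ltr_norml.
have : i%:R < N%:R :> R by rewrite ltr_nat.
have : j%:R < N%:R :> R by rewrite ltr_nat.
have := ler0n R i; have := ler0n R j.
by move=> *; apply/andP; split; lra.
Qed.

Lemma nodeB_unity_root i j : expi (node N j - node N i) ^+ N = 1 :> R[i].
Proof.
rewrite -expi_natmul.
have -> : N%:R * (node N j - node N i) = j%:R * (2 * pi) - i%:R * (2 * pi) :> R.
  by rewrite /node; field; rewrite pnatr_eq0 -lt0n.
have e k : expi (k%:R * (2 * pi)) = 1 :> R[i].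
  by rewrite expi_natmul expi_2pi expr1n.
(* Multiplying by [expi (i%:R * (2 * pi))], which is 1, cancels the subtracted turns. *)
by rewrite -[LHS]mulr1 -{1}(e i) -expiD subrK e.
Qed.

(** Off the diagonal, (z - 1) times the geometric sum is z^N - 1 = 0 while z differs from 1. *)
Lemma sum_expi_nodeB i j :
  \sum_(k < N) expi (node N j - node N i) ^+ k = (N * (j == i))%:R :> R[i].
Proof.
have [->|neq_ji] := eqVneq j i.
  rewrite subrr expi0 (eq_bigr (fun=> 1)) => [|k _]; last exact: expr1n.
  by rewrite sumr_const card_ord muln1.
rewrite muln0; set z := expi _.
have z1 : z - 1 != 0 by rewrite subr_eq0 nodeB_neq1// eq_sym.
by apply: (mulfI z1); rewrite -subrX1 nodeB_unity_root subrr mulr0.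
Qed.

Lemma fourier_mxK s : fourier_mx s *m fourier_inv s = 1%:M.
Proof.
apply/matrixP => j i; rewrite !mxE.
have N0 : N%:R != 0 :> R[i] by rewrite pnatr_eq0 -lt0n.
under eq_bigr => k _.
  rewrite !mxE rmorphM/= fmorphV rmorph_nat.
  (* The factors sqrt(2 pi) cancel, and the shift s contributes a factor independent of k, leaving a
     geometric sum. *)
  rewrite (_ : _ * _ = N%:R^-1 * (expi (s%:~R * (node N j - node N i)) *
      expi (node N j - node N i) ^+ k)); last first.
    rewrite -expi_natmul -expiD.
    rewrite (_ : _ + _ = (k%:Z + s)%:~R * node N j - (k%:Z + s)%:~R * node N i).
      by rewrite expiD; field; rewrite N0.
    by rewrite intrD -pmulrn; ring.
  over.
rewrite -mulr_sumr -mulr_sumr sum_expi_nodeB.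
case: eqVneq => [->|_]; last by rewrite muln0 !mulr0.
by rewrite subrr mulr0 expi0 mul1r muln1 mulVf.
Qed.

Lemma fourier_mx_unit s : fourier_mx s \in unitmx.
Proof. by case/mulmx1_unit: (fourier_mxK s). Qed.

(** The vector of the [ctilde] is [fourier_inv s] applied to the samples. *)
Lemma fourier_mx_ctilde s (f : R -> R[i]) :
  fourier_mx s *m (\col_k ctilde N f (k%:Z + s)) = samples N f.
Proof.
rewrite -[RHS]mul1mx -(fourier_mxK s) -mulmxA; congr (_ *m _).
apply/colP => k; rewrite !mxE /ctilde mulr_sumr; apply: eq_bigr => j _.
by rewrite !mxE -mulrA [f _ * _]mulrC.
Qed.

End DiscreteFourier.

(** * Even N: the cosine column and the primed sum *)

Section Even.
Context {R : realType} {N : nat}.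
Hypotheses (N_gt0 : (0 < N)%N) (N_even : ~~ odd N).

Let N2 : N = (N./2).*2. Proof. by rewrite -[LHS]odd_double_half (negbTE N_even). Qed.

Lemma half_node (j : nat) :
  N%:R / 2 * node N j = (j%:R - N./2%:R) * pi :> R.
Proof.
have N0 : N%:R != 0 :> R by rewrite pnatr_eq0 -lt0n.
have -> : N./2%:R = N%:R / 2 :> R.
  by rewrite [in RHS]N2 -mul2n natrM mulrC mulKf ?pnatr_eq0.
by rewrite /node; field.
Qed.

Lemma sin_half_node (j : nat) : sin (N%:R / 2 * node N j) = 0 :> R.
Proof.
(* sin (k pi) is the imaginary part of (e^{i pi})^k = (-1)^k, which is real. *)
have e k : sin (k%:R * pi) = 0 :> R.
  have := congr1 (@complex.Im R) (expi_natmul k pi).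
  rewrite expi_pi /= => ->; rewrite -signr_odd.
  by case: (odd k); rewrite /= ?expr1 ?expr0 /= ?oppr0.
by rewrite half_node mulrBl sinB !e mul0r mulr0 subrr.
Qed.

Lemma expi_half_node (j : nat) :
  expi (N%:R / 2 * node N j) = (cos (N%:R / 2 * node N j))%:C%C :> R[i].
Proof. by rewrite /expi sin_half_node. Qed.

Lemma half_intr : (N./2)%:Z%:~R = N%:R / 2 :> R.
Proof.
by rewrite -pmulrn [in RHS]N2 -mul2n natrM mulrC mulKf ?pnatr_eq0.
Qed.

Lemma ctilde_half_opp (f : R -> R[i]) :
  ctilde N f (- (N./2)%:Z) = ctilde N f (N./2)%:Z.
Proof.
rewrite /ctilde; congr (_ * _); apply: eq_bigr => j _; congr (_ * _).
rewrite mulrNz half_intr mulNr opprK /expi cosN sinN.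
by rewrite sin_half_node oppr0.
Qed.

Lemma freq_even_last : freq_even N N.-1 = (N./2)%:Z.
Proof.
by rewrite /freq_even addrAC -PoszD addn1 prednK// {1}N2 -addnn PoszD addrK.
Qed.

(** The cosine and the exponential of frequency n agree at the nodes, though not as functions. *)
Lemma Bmx_fourier : Bmx N = fourier_mx (1 - (N./2)%:Z) :> 'M[R[i]]_N.
Proof.
apply/matrixP => j k; rewrite !mxE /basis_even; congr (_ / _).
have -> : k%:Z + (1 - (N./2)%:Z) = freq_even N k by rewrite /freq_even; ring.
case: eqP => // ->.
by rewrite freq_even_last half_intr expi_half_node.
Qed.

(** The halved terms at -n and n share one coefficient by [ctilde_half_opp], so they add up to the
    cosine term; the others match one by one. *)
Lemma trig_poly_coef_even (f : R -> R[i]) :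
  trig_poly (basis_even N) (coef_even N f) = trig_interp_even N f.
Proof.
apply/funext => x; rewrite /trig_poly /trig_interp_even.
have := half_intr; have := ctilde_half_opp f; have := freq_even_last.
have := N2; rewrite /basis_even /coef_even /freq_even.
move: N_gt0; set n := N./2; move: n; case: N => // m n _ mn lastE ctN hI.
(* Split off the cosine term on the left and both ends -n, n on the right; m interior terms remain
   on each side. *)
rewrite big_ord_recr -mn [in RHS]big_ord_recl [in RHS]big_ord_recr.
rewrite !mxE /= eqxx lastE /bump !leq0n !add1n.
have -> : m.+1%:Z - n%:Z = n by rewrite mn -addnn PoszD addrK.
rewrite sub0r abszN absz_nat eqxx ctN mulrNz mulNr hI.
have -> : (cos (m.+1%:R / 2 * x))%:C%C =
    2^-1 * (expi (m.+1%:R / 2 * x) + expi (- (m.+1%:R / 2 * x))) :> R[i].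
  by rewrite expi_add_expiN rmorphM rmorph_nat mulKf// pnatr_eq0.
set S := (X in X + _ = _); set S' := \sum_(i < m) _.
have -> : S = ((Num.sqrt (2 * pi))^-1)%:C%C * S'.
  rewrite mulr_sumr; apply: eq_bigr => k _.
  rewrite mxE /= (_ : k%:Z - n%:Z + 1 = k.+1%:Z - n%:Z); last first.
    by rewrite addrAC -PoszD addn1.
  have lt_km := ltn_ord k.
  (* From k < m and m + 1 = 2n, the frequency k + 1 - n is strictly between -n and n, so its weight
     is 1. *)
  rewrite ltn_eqF// ifF ?mul1r ?fmorphV; last by apply/eqP; lia.
  by rewrite mulrA mulrC.
by rewrite fmorphV; ring.
Qed.

End Even.

(** * Odd N, and the conclusion for both parities *)

Lemma trig_poly_coef_odd (R : realType) (N : nat) (f : R -> R[i]) : odd N ->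
  trig_poly (basis_odd N) (coef_odd N f) = trig_interp_odd N f.
Proof.
move=> N_odd; apply/funext => x; rewrite /trig_poly /trig_interp_odd.
(* Reading the 1 in 2n + 1 as [odd N] makes the bound equal to N. *)
rewrite -[(N./2).*2.+1]/(true + (N./2).*2)%N -N_odd odd_double_half mulr_sumr.
by apply: eq_bigr => k _; rewrite mxE mulrA mulrC fmorphV.
Qed.

Theorem lemma3p1 (R : realType) (N : nat) (f : R -> R[i])
  (hN : (1 <= N)%N)
  (f_periodic : periodic f (2 * pi))
  (f_continuous : {within `[- pi, pi], continuous (f : R -> R[i]^o)})
  (f_nonzero : exists2 x : R, x \in `[- pi, pi] & f x != 0)
  (f_real : forall j : 'I_N, f (node N j) \is Num.real) :
  (odd N ->
     (forall alpha : 'cV[R[i]]_N,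
        minimizer (objective (Amx N) f) alpha <-> alpha = coef_odd N f) /\
     (forall alpha : 'cV[R[i]]_N,
        minimizer (objective (Amx N) f) alpha <->
        trig_poly (basis_odd N) alpha = trig_interp_odd N f)) /\
  (~~ odd N ->
     (forall beta : 'cV[R[i]]_N,
        minimizer (objective (Bmx N) f) beta <-> beta = coef_even N f) /\
     (forall beta : 'cV[R[i]]_N,
        minimizer (objective (Bmx N) f) beta <->
        trig_poly (basis_even N) beta = trig_interp_even N f)).
Proof.
split=> [N_odd|N_even].
- have A_unit : Amx N \in @unitmx R[i] N by exact: fourier_mx_unit.
  have Ac : Amx N *m coef_odd N f = samples N f by exact: fourier_mx_ctilde.
  have minP := minimizer_objectiveP hN _ A_unit Ac.
  split=> // alpha; rewrite minP -trig_poly_coef_odd//.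
  by split=> [->//|/(trig_poly_inj A_unit)].
- have B_unit : Bmx N \in @unitmx R[i] N.
    by rewrite Bmx_fourier// fourier_mx_unit.
  have Bc : Bmx N *m coef_even N f = samples N f.
    rewrite Bmx_fourier// -(fourier_mx_ctilde hN (1 - (N./2)%:Z)).
    by congr (_ *m _); apply/colP => k; rewrite !mxE /freq_even addrAC addrA.
  have minP := minimizer_objectiveP hN _ B_unit Bc.
  split=> // beta; rewrite minP -trig_poly_coef_even//.
  by split=> [->//|/(trig_poly_inj B_unit)].
Qed.
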